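(* Let $H$ be a hypergraph and let $v$ be a vertex of $H$ such that $v$ is not isolated in $H$ and $v$ is not contained in any induced Berge cycle of length $3$ in $H$. Let $e_1, e_2, \ldots, e_k$ be the edges of $H$ containing $v$ and put $\tilde{e}_i = e_i \setminus \{v\}$. Then \[ I(H) \simeq \Sigma\Big(\mathrm{st}(v) \cap \bigcup_{i=1}^{k} \mathrm{st}(\tilde{e}_i)\Big), \] where all stars are taken in $I(H)$ and $\simeq$ denotes homotopy equivalence.
   Context: A hypergraph $H$ on a finite set $V=V(H)$ is a collection of nonempty subsets of $V$, called edges. Standing convention: every edge of $H$ is inclusion-minimal (no edge properly contains another edge) and has size at least $2$. An independent set of $H$ is a subset of $V(H)$ containing no edge of $H$; the independence complex $I(H)$ is the simplicial complex of all independent sets of $H$. A vertex is isolated if it lies in no edge. A Berge cycle of length $k$ in $H$ is an alternating sequence $v_1 e_1 v_2 e_2 \cdots v_k e_k$ of $k$ distinct vertices and $k$ distinct edges of $H$ with $v_i, v_{i+1} \in e_i$ for all $i$ (indices modulo $k$); it is induced if $e_i \cap \{v_1,\ldots,v_k\} = \{v_i, v_{i+1}\}$ for all $i$ and no edge of $H$ contains two non-consecutive vertices of the cycle. For a simplicial complex $X$ on $V$ and $\sigma \in X$, the star is $\mathrm{st}_X(\sigma) = \{\tau \subseteq V : \tau \cup \sigma \in X\}$ (here $\mathrm{st}(v)$ means $\mathrm{st}(\{v\})$). $\Sigma X$ denotes the suspension of $X$. *)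

(* Defs.v *)
From HB Require Import structures.
From mathcomp Require Import all_boot all_order all_algebra.

Set Implicit Arguments.
Unset Strict Implicit.
Unset Printing Implicit Defensive.

Import Order.TTheory GRing.Theory Num.Theory.

(* Hypergraphs and simplicial complexes on a finite vertex set [V] are families
   of type [{set {set V}}]. *)

Section Hypergraph.
Variable V : finType.
Implicit Types (H X : {set {set V}}) (v : V) (A e s : {set V}) (k : nat).

Definition is_hypergraph H : Prop :=
  (forall e, e \in H -> (2 <= #|e|)%N) /\
  (forall e e', e \in H -> e' \in H -> ~~ (e \proper e')).

Definition isolated_vertex H v : Prop := forall e, e \in H -> v \notin e.

Definition independent H A : bool := [forall e in H, ~~ (e \subset A)].

Definition independence_complex H : {set {set V}} := [set A | independent H A].

Definition star X s : {set {set V}} := [set t | t :|: s \in X].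

(* The cycle [w 0, c 0, w 1, c 1, ...]: [ordS] is the successor of ['I_k]
   modulo [k]. *)
Definition berge_cycle H k (w : 'I_k -> V) (c : 'I_k -> {set V}) : Prop :=
  [/\ injective w, injective c, forall i, c i \in H &
      forall i, w i \in c i /\ w (ordS i) \in c i].

Definition induced_berge_cycle H k (w : 'I_k -> V) (c : 'I_k -> {set V}) :
    Prop :=
  [/\ berge_cycle H w c,
      forall i, c i :&: [set w j | j : 'I_k] = [set w i; w (ordS i)] &
      forall i j, j != i -> j != ordS i -> i != ordS j ->
        forall e, e \in H -> ~ (w i \in e /\ w j \in e)].

Definition in_induced_berge_cycle H k v : Prop :=
  exists (w : 'I_k -> V) (c : 'I_k -> {set V}),
    induced_berge_cycle H w c /\ exists i, w i = v.

End Hypergraph.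

(* The simplicial suspension: the join of [X] with the two points [inr true]
   and [inr false].  With this definition the suspension of the complex whose
   only face is the empty set is the 0-sphere. *)
Definition suspension (V : finType) (X : {set {set V}}) :
    {set {set V + bool}} :=
  [set s : {set V + bool} | ([set u | inl u \in s] \in X) &&
                            ~~ ((inr true \in s) && (inr false \in s))].

From mathcomp Require Import all_classical all_reals topology normedtype.
Import numFieldNormedType.Exports.

Local Open Scope classical_set_scope.
Local Open Scope ring_scope.

(* The geometric realization, by barycentric coordinates. *)
Definition realization (R : realType) (V : finType) (X : {set {set V}}) :
    set {ptws V -> R} :=
  [set x : {ptws V -> R} | [/\ forall u, 0 <= x u, \sum_u x u = 1 &
                               [set u | x u != 0]%SET \in X]].
Arguments realization R {V} X.

(* A homotopy [f ~ g] of maps from the subspace [A] to the subspace [B]; only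
   the values on [A] (resp. on [A `*` `[0, 1]]) matter. *)
Definition homotopic_maps (R : realType) (T U : topologicalType)
    (A : set T) (B : set U) (f g : T -> U) : Prop :=
  exists h : T * R -> U,
    [/\ {within A `*` `[0, 1], continuous h},
        forall (x : T) (t : R), A x -> 0 <= t <= 1 -> B (h (x, t)),
        forall x, A x -> h (x, 0) = f x &
        forall x, A x -> h (x, 1) = g x].

Definition homotopy_equivalent (R : realType) (T U : topologicalType)
    (A : set T) (B : set U) : Prop :=
  exists (f : T -> U) (g : U -> T),
    [/\ {within A, continuous f} /\ (forall x, A x -> B (f x)),
        {within B, continuous g} /\ (forall y, B y -> A (g y)),
        homotopic_maps R A A (g \o f) id &
        homotopic_maps R B B (f \o g) id].

Definition complex_homotopy_equivalent (R : realType) (V W : finType)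
    (X : {set {set V}}) (Y : {set {set W}}) : Prop :=
  homotopy_equivalent R (realization R X) (realization R Y).

(* Main.v *)
(* Write I for the independence complex, A for the star of v, and B for the
   union of the stars of the links e \ v over the edges e through v.  Then
   I = A U B.  A is a cone, and B is contractible: for an edge f avoiding v, the
   traces on f of the sets e \ v form a chain, as otherwise v would lie on an
   induced Berge 3-cycle; hence whenever a face T is compatible with several
   links it is compatible with their union.

   The homotopy equivalence is given by explicit maps in barycentric
   coordinates x >= 0.  [apex_gauge x] and [links_gauge x] are homogeneous
   continuous functions such that the vertices of weight > d form a face of A
   (resp. B) iff the gauge is <= d; so at least one of them vanishes on I.
   [to_suspension] truncates x at the sum of the gauges, which lands in A & B,
   and uses the gauges themselves as weights of the two tips.  [of_suspension]
   sends the tip [inr true] to v; it truncates at the weight t of the tip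
   [inr false] and adds each link e \ v with weight max(0, t - edge_gauge e x),
   which is positive only if e \ v is compatible with the truncation.  Both maps
   are homogeneous, so it does not matter where a composite is normalized. *)
Require Import Defs.
From mathcomp Require Import all_boot all_order all_algebra.

Set Implicit Arguments.
Unset Strict Implicit.
Unset Printing Implicit Defensive.

Import Order.TTheory GRing.Theory Num.Theory.

(** * Faces of the two stars, and traces of links on an edge *)

Section Combinatorics.
Variables (V : finType) (H : {set {set V}}) (v : V).
Hypothesis hypH : is_hypergraph H.
Implicit Types (S : {set {set V}}) (T e f : {set V}).

Local Notation Ind := (independence_complex H).

Definition star_apex : {set {set V}} := star Ind [set v].
Definition star_links : {set {set V}} :=
  \bigcup_(e in H | v \in e) star Ind (e :\ v).

Lemma independentP T :
  reflect (forall f, f \in H -> ~~ (f \subset T)) (T \in Ind).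
Proof. by rewrite inE; exact: forall_inP. Qed.

Lemma independentS T T' : T' \subset T -> T \in Ind -> T' \in Ind.
Proof.
move=> sT /independentP iT; apply/independentP => f fH.
by apply: contra (iT f fH) => /subset_trans; apply.
Qed.

Lemma star_apexS T T' : T' \subset T -> T \in star_apex -> T' \in star_apex.
Proof.
move=> sT; rewrite [T \in _]inE => iT; rewrite [T' \in _]inE.
exact: independentS (setSU _ sT) iT.
Qed.

Lemma star_linksP T :
  reflect (exists e, [/\ e \in H, v \in e & T :|: (e :\ v) \in Ind])
          (T \in star_links).
Proof.
apply: (iffP bigcupP) => [[e /andP[eH ve]]|[e [eH ve]]].
  by rewrite [T \in _]inE => iT; exists e.
by move=> iT; exists e; rewrite ?eH // [T \in _]inE.
Qed.

Lemma star_linksS T T' : T' \subset T -> T \in star_links -> T' \in star_links.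
Proof.
move=> sT /star_linksP[e [eH ve iT]]; apply/star_linksP; exists e; split=> //.
exact: independentS (setSU _ sT) iT.
Qed.

Lemma star_apex_indep T : T \in star_apex -> T \in Ind.
Proof.
by rewrite [T \in star_apex]inE; apply: independentS; exact: subsetUl.
Qed.

Lemma star_links_indep T : T \in star_links -> T \in Ind.
Proof.
by move=> /star_linksP[e [_ _]]; apply: independentS; exact: subsetUl.
Qed.

(** If [v] were in [T], then [T] together with [e :\ v] would contain the edge [e]. *)
Lemma star_links_apex T : T \in star_links -> v \notin T.
Proof.
case/star_linksP=> e [eH ve /independentP/(_ e eH)].
apply: contra => vT; apply/subsetP => u ue; rewrite !inE ue andbT.
by have [->|] := eqVneq u v; rewrite ?vT ?orbT.
Qed.

Lemma link_neq0 e : e \in H -> e :\ v != set0.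
Proof.
move=> eH; rewrite -card_gt0.
by have := hypH.1 e eH; rewrite (cardsD1 v e); case: (v \in e) => //;
  case: #|_|.
Qed.

(** By minimality [f] is not a proper subset of [e], and [v] tells the two apart. So the minimum of
    weights over [f :\: e] is never an empty one. *)
Lemma edgeD_neq0 e f : e \in H -> f \in H -> v \in e -> v \notin f ->
  f :\: e != set0.
Proof.
move=> eH fH ve vf; rewrite setD_eq0.
by have := hypH.2 f e fH eH; rewrite properE negb_and negbK =>
  /orP[//|/subsetP/(_ v ve)]; rewrite (negbTE vf).
Qed.

(** An edge avoiding [v] cannot become covered when [v] is added to [T], so only edges through [v]
    obstruct. The criterion bears on subsets of [T], which weights can test. *)
Lemma star_apexE T : T \in Ind ->
  (T \in star_apex) = [forall (e | (e \in H) && (v \in e)),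
    ~~ (e :\ v \subset T)].
Proof.
move=> /independentP iT; apply/idP/forall_inP.
  rewrite inE => /independentP iTv e /andP[eH ve].
  by have := iTv e eH; apply: contra; rewrite subDset setUC.
move=> h; rewrite inE; apply/independentP => f fH.
have [vf|vf] := boolP (v \in f).
  by have := h f; rewrite fH vf => /(_ isT); apply: contra;
    rewrite subDset setUC.
apply: contra (iT f fH) => /subsetP sf; apply/subsetP => u uf.
by have := sf u uf; rewrite !inE => /orP[//|/eqP uv]; rewrite -uv uf in vf.
Qed.

(** Edges through [v] never obstruct, since [v] is in neither [T] nor the link. An edge [f] avoiding
    [v] is covered exactly when [T] supplies the part of [f] outside [e]. *)
Lemma setU_link_indep e T : v \in e -> v \notin T ->
  (T :|: (e :\ v) \in Ind) = [forall (f | (f \in H) && (v \notin f)),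
    ~~ (f :\: e \subset T)].
Proof.
move=> ve vT.
have sE f : v \notin f -> (f :\: e \subset T) = (f \subset T :|: (e :\ v)).
  move=> vf; rewrite subDset setUC; apply/subsetP/subsetP => sf u uf.
    have := sf u uf; rewrite !inE => /orP[->//|->].
    by case: eqVneq => [uv|]; rewrite ?orbT // -uv uf in vf *.
  by have := sf u uf; rewrite !inE => /orP[->//|/andP[_ ->]]; rewrite orbT.
apply/independentP/forall_inP => [h f /andP[fH vf]|h f fH];
  first by rewrite sE ?h.
have [vf|vf] := boolP (v \in f); last by rewrite -sE ?h ?fH.
by apply/subsetPn; exists v; rewrite // !inE eqxx (negbTE vT).
Qed.

(** If adding [v] to [T] completes an edge [e], then [T] already contains [e :\ v], and adding this
    link changes nothing. *)
Lemma star_apexU_links T : T \in Ind -> (T \in star_apex) || (T \in star_links).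
Proof.
move=> iT; rewrite star_apexE //; case: forall_inP => //= /forall_inP.
rewrite negb_forall_in => /exists_inP[e /andP[eH ve]]; rewrite negbK => sT.
by apply/star_linksP; exists e; split=> //; rewrite (setUidPl sT).
Qed.

(** Otherwise [a] and [b] witness that the traces of [e1] and [e2] on [f] are incomparable, and
    [v e1 a f b e2] is an induced Berge cycle. *)
Lemma link_traces_chain e1 e2 f a b :
  ~ in_induced_berge_cycle H 3 v ->
  e1 \in H -> e2 \in H -> f \in H -> v \in e1 -> v \in e2 -> v \notin f ->
  a \in f -> b \in f -> a \in e1 -> a \notin e2 -> b \in e2 -> b \in e1.
Proof.
move=> nocyc e1H e2H fH ve1 ve2 vf af bf ae1 ae2 be2; apply/negPn/negP => be1.
have av : a != v by apply: contraNneq vf => <-.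
have bv : b != v by apply: contraNneq vf => <-.
have ab : a != b by apply: contraNneq be1 => <-.
apply: nocyc; pose w := fun i : 'I_3 => nth v [:: v; a; b] i.
pose c := fun i : 'I_3 => nth f [:: e1; f; e2] i.
have e1f : e1 != f by apply: contraNneq vf => <-.
have e2f : e2 != f by apply: contraNneq vf => <-.
have e12 : e1 != e2 by apply: contraNneq be1 => ->.
exists w, c; split; last by exists ord0.
split; first split.
- move=> i j /eqP; rewrite nth_uniq // => [/eqP|]; first exact: val_inj.
  by rewrite /= !inE negb_or ab eq_sym av eq_sym bv.
- move=> i j /eqP; rewrite nth_uniq // => [/eqP|]; first exact: val_inj.
  by rewrite /= !inE negb_or e12 e1f eq_sym e2f.
- by case=> [[|[|[]]]].
- by case=> [[|[|[]]]].
- have imw : [set w j | j : 'I_3] = [set v; a; b].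
    apply/setP => u; apply/imsetP/idP => [[[[|[|[|]]] //= ?] _ ->]|].
    + by rewrite /w /= !inE eqxx.
    + by rewrite /w /= !inE eqxx orbT.
    + by rewrite /w /= !inE eqxx orbT.
    rewrite !inE => /orP[/orP[]|] /eqP->.
    + by exists ord0.
    + by exists (@Ordinal 3 1 isT).
    + by exists (@Ordinal 3 2 isT).
  rewrite imw => -[[|[|[|]]] // ?]; apply/setP => u; rewrite /w /c /= !inE.
  + case: (eqVneq u v) => [->|_]; first by rewrite ve1.
    case: (eqVneq u a) => [->|_]; first by rewrite ae1.
    by case: (eqVneq u b) => [->|_]; rewrite ?(negbTE be1) ?andbF.
  + case: (eqVneq u v) => [->|_].
      by rewrite (negbTE vf) eq_sym (negbTE av) eq_sym (negbTE bv).
    case: (eqVneq u a) => [->|_]; first by rewrite af.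
    by case: (eqVneq u b) => [->|_]; rewrite ?bf ?andbF.
  + case: (eqVneq u v) => [->|_]; first by rewrite ve2 orbT.
    case: (eqVneq u a) => [->|_]; first by rewrite (negbTE ae2) (negbTE ab).
    by case: (eqVneq u b) => [->|_]; rewrite ?be2 ?andbF.
(* Any two vertices of a 3-cycle are consecutive, so this condition is vacuous. *)
- by case=> [[|[|[|]]] // ?] [[|[|[|]]] // ?].
Qed.

(* Among the links in [S], the one with the largest trace on an edge [f]
   contains the traces of all the others. *)
Lemma star_linksU S T : ~ in_induced_berge_cycle H 3 v ->
  S != set0 -> v \notin T ->
  (forall e, e \in S -> [/\ e \in H, v \in e & T :|: (e :\ v) \in Ind]) ->
  T :|: \bigcup_(e in S) (e :\ v) \in star_links.
Proof.
move=> nocyc /set0Pn[e0 e0S] vT hS; set N := \bigcup_(e in S) _.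
have vN : v \notin N.
  by apply/negP => /bigcupP[e _]; rewrite !inE eqxx.
(* [N] absorbs the link of [e0], so independence of the union already puts it in the star of that
   link. *)
suff iN : T :|: N \in Ind.
  apply/star_linksP; exists e0; have [e0H ve0 _] := hS _ e0S; split=> //.
  by rewrite -setUA (setUidPl (bigcup_sup _ e0S)).
apply/independentP => f fH; apply/negP => sf.
have vf : v \notin f.
  by apply/negP => /(subsetP sf); rewrite inE (negbTE vT) (negbTE vN).
have [e eS emax] := arg_maxnP (fun e : {set V} => #|f :&: e|) e0S.
have [eH ve /independentP/(_ f fH)/negP] := hS _ eS; apply.
apply/subsetP => b bf; have := subsetP sf b bf; rewrite !inE.
case/orP=> [->//|/bigcupP[e' e'S]]; rewrite !inE => /andP[bv be'].
rewrite bv /=; apply/orP; right; have [//|be] := boolP (b \in e).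
have [e'H ve' _] := hS _ e'S.
(* If the trace of [e] were inside that of [e'], then [b] would make the inclusion strict, against
   maximality. The vertex [a] found here makes the chain property put [b] in [e]. *)
have /subsetPn[a] : ~~ (f :&: e \subset f :&: e').
  apply/negP => s; have : f :&: e \proper f :&: e'.
    rewrite properE s; apply/subsetPn; exists b; first by rewrite inE bf.
    by rewrite inE bf.
  by move/proper_card; rewrite ltnNge; have := emax _ e'S => /= ->.
rewrite !inE => /andP[af ae]; rewrite af /= => ae'.
by have := link_traces_chain nocyc eH e'H fH ve ve' vf af bf ae ae' be';
  rewrite (negbTE be).
Qed.

End Combinatorics.

From mathcomp Require Import all_classical all_reals topology normedtype.
Import numFieldNormedType.Exports.

Local Open Scope ring_scope.

(** * Continuity of real functions built by finite operations *)

Section Continuity.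
Variables (R : realType) (T : topologicalType).
Implicit Types f g : T -> R.

(** The default [idx] varies with the point, because the minima below default to the total
    weight. *)
Lemma continuous_bigop (I : Type) (op : R -> R -> R) (idx : T -> R)
    (r : seq I) (P : pred I) (F : I -> T -> R) :
  (forall f g, continuous f -> continuous g ->
     continuous (fun p => op (f p) (g p))) ->
  continuous idx -> (forall i, P i -> continuous (F i)) ->
  continuous (fun p => \big[op/idx p]_(i <- r | P i) F i p).
Proof.
move=> opc idxc Fc; elim: r => [|i r IH].
  by under eq_fun => p do rewrite big_nil.
have [Pi|nPi] := boolP (P i); last first.
  by under eq_fun => p do rewrite big_cons (negbTE nPi).
under eq_fun => p do rewrite big_cons Pi.
by apply: opc => //; exact: Fc.
Qed.

Lemma continuous_maxr f g : continuous f -> continuous g ->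
  continuous (fun p => Num.max (f p) (g p)).
Proof. by move=> fc gc p; exact: (@continuous_max R T f g p (fc p) (gc p)). Qed.

Lemma continuous_minr f g : continuous f -> continuous g ->
  continuous (fun p => Num.min (f p) (g p)).
Proof. by move=> fc gc p; exact: (@continuous_min R T f g p (fc p) (gc p)). Qed.

Lemma continuous_addr f g : continuous f -> continuous g ->
  continuous (fun p => f p + g p).
Proof.
by move=> fc gc p; exact: (@continuousD _ R^o T f g p (fc p) (gc p)).
Qed.

Lemma continuous_subr f g : continuous f -> continuous g ->
  continuous (fun p => f p - g p).
Proof.
by move=> fc gc p; exact: (@continuousB _ R^o T f g p (fc p) (gc p)).
Qed.

Lemma continuous_mulr f g : continuous f -> continuous g ->
  continuous (fun p => f p * g p).
Proof. by move=> fc gc p; exact: (@continuousM _ T f g p (fc p) (gc p)). Qed.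

Lemma continuous_sumr (I : Type) (r : seq I) (P : pred I) (F : I -> T -> R) :
  (forall i, P i -> continuous (F i)) ->
  continuous (fun p => \sum_(i <- r | P i) F i p).
Proof.
move=> Fc; apply: (continuous_bigop (idx := fun=> 0)) => //.
  exact: continuous_addr.
by move=> p; exact: cvg_cst.
Qed.

(** The pointwise topology is the supremum of the topologies induced by the evaluations, so
    coordinates suffice. *)
Lemma continuous_ptws (W : Type) (p : T) (f : T -> {ptws W -> R}) :
  (forall w, {for p, continuous (fun q => f q w)}) -> {for p, continuous f}.
Proof.
move=> fc; apply/cvg_sup => w U [? /= [[B oB <-]]] /= Bfp /filterS; apply.
by apply: fc; exact: open_nbhs_nbhs.
Qed.

End Continuity.

Lemma continuous_eval (R : realType) (W : eqType) (w : W) :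
  continuous (fun x : {ptws W -> R} => x w).
Proof. exact: (@proj_continuous W (fun=> R) w). Qed.

(** * From nonnegative weights to points of a realization *)

Section Normalization.
Variables (R : realType) (W : finType).
Implicit Types (a b : W -> R) (c : R) (w : W).

Definition normalize a : {ptws W -> R} := fun w => a w / \sum_w' a w'.

(** For nonnegative [a], [cut 0 a] is the support, that is, the face carrying the point; [cut d a]
    is the support after truncation at [d]. *)
Definition cut (d : R) a : {set W} := [set w | d < a w]%SET.

Lemma cutS c d a : c <= d -> cut d a \subset cut c a.
Proof.
by move=> cd; apply/fintype.subsetP => w; rewrite !inE;
  exact: le_lt_trans.
Qed.

Lemma sum_gt0P a : (forall w, 0 <= a w) ->
  reflect (exists w, 0 < a w) (0 < \sum_w a w).
Proof.
move=> a0; rewrite lt0r sumr_ge0 // andbT psumr_neq0 //.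
apply: (iffP hasP) => [[w _ /=]|[w aw]]; first by exists w.
by exists w; rewrite ?mem_index_enum.
Qed.

Lemma normalizeZ c a : c != 0 -> normalize (fun w => c * a w) = normalize a.
Proof.
move=> c0; apply/funext => w; rewrite /normalize -mulr_sumr invfM mulrACA.
by rewrite divff ?mul1r.
Qed.

Lemma normalize_id a : \sum_w a w = 1 -> normalize a = a.
Proof. by move=> a1; apply/funext => w; rewrite /normalize a1 divr1. Qed.

Lemma normalizeE a : normalize a = (fun w => (\sum_w' a w')^-1 * a w).
Proof. by apply/funext => w; rewrite mulrC. Qed.

Lemma normalize_realization (X : {set {set W}}) a :
  (forall w, 0 <= a w) -> (exists w, 0 < a w) -> cut 0 a \in X ->
  realization R X (normalize a).
Proof.
move=> a0 /(sum_gt0P a0) sa aX; rewrite /normalize; split=> [w||].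
- by rewrite divr_ge0 // ltW.
- by rewrite -mulr_suml divff ?gt_eqF.
suff -> : [set u | normalize a u != 0]%SET = cut 0 a by [].
apply/setP => w; rewrite !inE /normalize mulf_eq0 invr_eq0.
by rewrite (gt_eqF sa) orbF lt0r a0 andbT.
Qed.

Lemma realization_ge0 (X : {set {set W}}) (x : {ptws W -> R}) :
  realization R X x -> forall w, 0 <= x w.
Proof. by case. Qed.

Lemma realization_sum (X : {set {set W}}) (x : {ptws W -> R}) :
  realization R X x -> \sum_w x w = 1.
Proof. by case. Qed.

Lemma realization_gt0 (X : {set {set W}}) (x : {ptws W -> R}) :
  realization R X x -> exists w, 0 < x w.
Proof.
by move=> [x0 x1 _]; apply/sum_gt0P => //; rewrite x1 ltr01.
Qed.

Lemma realization_cut (X : {set {set W}}) (x : {ptws W -> R}) :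
  realization R X x -> cut 0 x \in X.
Proof.
case=> x0 _; suff -> : [set u | x u != 0]%SET = cut 0 x by [].
by apply/setP => w; rewrite !inE lt0r x0 andbT.
Qed.

(** Continuity is claimed only within [D], where the total weight is positive and its inverse
    continuous. *)
Lemma continuous_normalize (T : topologicalType) (D : set T) (a : T -> W -> R) :
  (forall w, continuous (fun p => a p w)) ->
  (forall p, D p -> 0 < \sum_w a p w) ->
  {within D, continuous (fun p => normalize (a p))}%classic.
Proof.
move=> ac a0; apply: continuous_in_subspaceT => p /[!inE] Dp.
apply: continuous_ptws => w; rewrite /normalize.
apply: (@continuousM _ T (fun q => a q w) (fun q => (\sum_w' a q w')^-1)).
  exact: ac.
apply: (@continuousV _ T (fun q => \sum_w' a q w'));
  first by rewrite gt_eqF ?a0.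
by apply: continuous_sumr => w' _; exact: ac.
Qed.

End Normalization.

(** * Gauges measuring how far a point is from each star *)

Section Gauges.
Variables (R : realType) (V : finType) (H : {set {set V}}) (v : V).
Hypothesis hypH : is_hypergraph H.
Implicit Types (x : V -> R) (S e f : {set V}) (c d : R).

Local Notation Ind := (independence_complex H).
Local Notation A := (star_apex H v).
Local Notation B := (star_links H v).

(* The default value, the total weight, keeps [min_on] homogeneous in [x]. *)
Definition min_on x S : R := \big[Num.min/(\sum_u x u)]_(u in S) x u.

(** For an edge [e] through [v], this is the least level at which no edge avoiding [v] lies in the
    truncated support together with [e :\ v]. *)
Definition edge_gauge e x : R :=
  \big[Num.max/0]_(f in H | v \notin f) min_on x (f :\: e).

Definition apex_gauge x : R :=
  \big[Num.max/0]_(e in H | v \in e) min_on x (e :\ v).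

(** The term [x v] is there because no face of [B] contains [v]; the minimum over [e] reflects that
    [B] is a union of stars. *)
Definition links_gauge x : R :=
  Num.max (x v)
    (\big[Num.min/(\sum_u x u)]_(e in H | v \in e) edge_gauge e x).

Lemma le_sum x u : (forall w, 0 <= x w) -> x u <= \sum_w x w.
Proof. by move=> x0; rewrite (bigD1 u) //= lerDl sumr_ge0. Qed.

Lemma lt_min_on d x S : (forall w, 0 <= x w) -> S != finset.set0 ->
  (d < min_on x S) = (S \subset cut d x).
Proof.
move=> x0 /set0Pn[u0 u0S]; apply/bigmin_gtP/fintype.subsetP => [[_ h] u uS|h].
  by rewrite inE h.
split=> [|u /h]; last by rewrite inE.
(* The default is harmless for nonempty [S]: the total weight is at least the weight of [u0], which
   exceeds [d]. *)
by have := h _ u0S; rewrite inE => /lt_le_trans; apply; exact: le_sum.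
Qed.

Lemma min_on_le d x S : (forall w, 0 <= x w) -> S != finset.set0 ->
  (min_on x S <= d) = ~~ (S \subset cut d x).
Proof. by move=> x0 S0; rewrite leNgt lt_min_on. Qed.

Lemma edge_gauge_le d e x : (forall w, 0 <= x w) -> 0 <= d ->
  e \in H -> v \in e ->
  (edge_gauge e x <= d) =
  [forall (f | (f \in H) && (v \notin f)), ~~ (f :\: e \subset cut d x)].
Proof.
move=> x0 d0 eH ve; apply/bigmax_leP/forall_inP => [[_ h] f /andP[fH vf]|h].
  rewrite -min_on_le //; first by apply: h; rewrite fH.
  exact: (edgeD_neq0 hypH eH fH ve vf).
split=> // f /andP[fH vf].
rewrite min_on_le //; first by apply: h; rewrite fH.
exact: (edgeD_neq0 hypH eH fH ve vf).
Qed.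

Lemma edge_gauge_indep d e x : (forall w, 0 <= x w) -> 0 <= d ->
  e \in H -> v \in e -> v \notin cut d x ->
  (edge_gauge e x <= d) = (cut d x :|: (e :\ v) \in Ind).
Proof. by move=> x0 d0 eH ve vx; rewrite edge_gauge_le // setU_link_indep. Qed.

Lemma edge_gauge_ge0 e x : 0 <= edge_gauge e x.
Proof. exact: bigmax_ge_id. Qed.

Lemma apex_gauge_ge0 x : 0 <= apex_gauge x.
Proof. exact: bigmax_ge_id. Qed.

Lemma links_gauge_ge0 x : (forall w, 0 <= x w) -> 0 <= links_gauge x.
Proof. by move=> x0; rewrite le_max x0. Qed.

Lemma apex_gauge_le d x : (forall w, 0 <= x w) -> 0 <= d -> cut d x \in Ind ->
  (apex_gauge x <= d) = (cut d x \in A).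
Proof.
move=> x0 d0 xI; rewrite star_apexE //.
apply/bigmax_leP/forall_inP => [[_ h] e /andP[eH ve]|h].
  by rewrite -min_on_le ?(link_neq0 v hypH) // h // eH.
by split=> // e /andP[eH ve]; rewrite min_on_le ?(link_neq0 v hypH) // h // eH.
Qed.

Lemma links_gauge_le d x : ~ isolated_vertex H v ->
  (forall w, 0 <= x w) -> 0 <= d -> (links_gauge x <= d) = (cut d x \in B).
Proof.
move=> niso x0 d0; rewrite ge_max.
have [xv|vx] := leP (x v) d; last first.
  by apply/esym/negP => /star_links_apex; rewrite inE vx.
have vd : v \notin cut d x by rewrite inE -leNgt.
apply/idP/star_linksP => [|[e [eH ve xe]]]; last first.
  by apply: (@bigmin_inf _ _ _ _ e); rewrite ?eH // edge_gauge_indep.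
have [[e /andP[eH ve] ed] _|h] := pselect (exists2 e, (e \in H) && (v \in e)
  & edge_gauge e x <= d).
  by exists e; rewrite -edge_gauge_indep.
(* No edge gauge is at most [d], so only the default could be. In that case no vertex weighs more
   than [d], and any edge through [v], which exists by non-isolation, has gauge at most [d] after
   all. *)
have [dx|xd] := ltP d (\sum_u x u).
  rewrite leNgt; case: bigmin_gtP => // -[]; split=> // e He.
  by rewrite ltNge; apply/negP => ed; apply: h; exists e.
case: niso => e eH; apply/negP => ve; apply: h; exists e; rewrite ?eH //.
rewrite edge_gauge_le //; apply/forall_inP => f /andP[fH vf].
have /set0Pn[u uf] := edgeD_neq0 hypH eH fH ve vf.
apply/subsetPn; exists u; rewrite // inE -leNgt.
exact: le_trans (le_sum _ x0) xd.
Qed.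

Lemma apex_gauge_eq0 x : (forall w, 0 <= x w) -> cut 0 x \in Ind ->
  (apex_gauge x == 0) = (cut 0 x \in A).
Proof.
by move=> x0 xI; rewrite -apex_gauge_le // eq_le apex_gauge_ge0 andbT.
Qed.

Lemma links_gauge_eq0 x : ~ isolated_vertex H v -> (forall w, 0 <= x w) ->
  (links_gauge x == 0) = (cut 0 x \in B).
Proof.
by move=> ni x0; rewrite -links_gauge_le // eq_le (links_gauge_ge0 x0) andbT.
Qed.

Lemma min_onZ c x S : 0 <= c -> min_on (fun u => c * x u) S = c * min_on x S.
Proof.
move=> c0; rewrite /min_on -mulr_sumr.
rewrite [RHS](big_morph ( *%R c) (id1 := c * \sum_u x u) (op1 := Num.min)) //.
by move=> a b; rewrite minr_pMr.
Qed.

Lemma edge_gaugeZ c e x : 0 <= c ->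
  edge_gauge e (fun u => c * x u) = c * edge_gauge e x.
Proof.
move=> c0; rewrite /edge_gauge [RHS](big_morph ( *%R c) (id1 := 0)
  (op1 := Num.max)).
- by apply: eq_bigr => f _; rewrite min_onZ.
- by move=> a b; rewrite maxr_pMr.
- by rewrite mulr0.
Qed.

Lemma apex_gaugeZ c x : 0 <= c ->
  apex_gauge (fun u => c * x u) = c * apex_gauge x.
Proof.
move=> c0; rewrite /apex_gauge [RHS](big_morph ( *%R c) (id1 := 0)
  (op1 := Num.max)).
- by apply: eq_bigr => f _; rewrite min_onZ.
- by move=> a b; rewrite maxr_pMr.
- by rewrite mulr0.
Qed.

Lemma links_gaugeZ c x : 0 <= c ->
  links_gauge (fun u => c * x u) = c * links_gauge x.
Proof.
move=> c0; rewrite /links_gauge maxr_pMr // -mulr_sumr; congr Num.max.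
rewrite [RHS](big_morph ( *%R c) (id1 := c * \sum_u x u) (op1 := Num.min)) //.
- by apply: eq_bigr => e _; rewrite edge_gaugeZ.
- by move=> a b; rewrite minr_pMr.
Qed.

Variables (T : topologicalType) (x : T -> V -> R).
Hypothesis xc : forall u, continuous (fun p => x p u).

Let sumc : continuous (fun p => \sum_u x p u).
Proof. by apply: continuous_sumr => u _; exact: xc. Qed.

Lemma continuous_min_on S : continuous (fun p => min_on (x p) S).
Proof.
apply: continuous_bigop => //; exact: continuous_minr.
Qed.

Lemma continuous_edge_gauge e : continuous (fun p => edge_gauge e (x p)).
Proof.
apply: (continuous_bigop (idx := fun=> 0)); first exact: continuous_maxr.
  by move=> p; exact: cvg_cst.
by move=> f _; exact: continuous_min_on.
Qed.

Lemma continuous_apex_gauge : continuous (fun p => apex_gauge (x p)).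
Proof.
apply: (continuous_bigop (idx := fun=> 0)); first exact: continuous_maxr.
  by move=> p; exact: cvg_cst.
by move=> e _; exact: continuous_min_on.
Qed.

Lemma continuous_links_gauge : continuous (fun p => links_gauge (x p)).
Proof.
apply: continuous_maxr => //; apply: continuous_bigop => //.
  exact: continuous_minr.
by move=> e _; exact: continuous_edge_gauge.
Qed.

End Gauges.

(** * The two maps, their homogeneity, and the homotopies between their composites and the
    identities *)

Section SuspensionMaps.
Variables (R : realType) (V : finType) (H : {set {set V}}) (v : V).
Hypothesis hypH : is_hypergraph H.
Hypothesis not_isolated : ~ isolated_vertex H v.
Hypothesis no_cycle : ~ in_induced_berge_cycle H 3 v.
Implicit Types (x : V -> R) (z : V + bool -> R) (c r : R).

Local Notation Ind := (independence_complex H).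
Local Notation A := (star_apex H v).
Local Notation B := (star_links H v).
Local Notation C := (star_apex H v :&: star_links H v)%SET.
Local Notation base z := (fun u => z (inl u)).

(** The factor [r] is the homotopy parameter: [r = 1] gives the map itself, while at [r = 0] nothing
    is truncated and both tips have weight 0. *)
Definition to_suspension r x : V + bool -> R := fun i =>
  match i with
  | inl u => Num.max 0 (x u - r * (apex_gauge H v x + links_gauge H v x))
  | inr true => r * links_gauge H v x
  | inr false => r * apex_gauge H v x
  end.

Definition of_suspension z : V -> R := fun u =>
  Num.max 0 (z (inl u) - z (inr false)) + z (inr true) * (u == v)%:R +
  \sum_(e in H | (v \in e) && (u \in (e :\ v)%SET))
     Num.max 0 (z (inr false) - edge_gauge H v e (base z)).

Definition flatten_tips r z : V + bool -> R := fun i =>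
  match i with inl u => z (inl u) | inr b => r * z (inr b) end.

(* At [r = 0] the gauges vanish, and the added terms give the tips their weights
   back. *)
Definition push_tips r z : V + bool -> R := fun i =>
  to_suspension 1 (of_suspension (flatten_tips r z)) i +
  match i with inl _ => 0 | inr b => (1 - r) * z (inr b) end.

Lemma to_suspension_ge0 r x : 0 <= r -> (forall u, 0 <= x u) ->
  forall i, 0 <= to_suspension r x i.
Proof.
move=> r0 x0 [u|[]] /=; rewrite ?le_max ?lexx //.
  by rewrite mulr_ge0 ?links_gauge_ge0.
by rewrite mulr_ge0 ?apex_gauge_ge0.
Qed.

Lemma of_suspension_ge0 z : (forall i, 0 <= z i) ->
  forall u, 0 <= of_suspension z u.
Proof.
move=> z0 u; rewrite !addr_ge0 ?mulr_ge0 ?le_max ?lexx //.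
by apply: sumr_ge0 => e _; rewrite le_max lexx.
Qed.

Lemma to_suspensionZ r c x : 0 <= c ->
  to_suspension r (fun u => c * x u) = (fun i => c * to_suspension r x i).
Proof.
move=> c0; apply/funext => -[u|[]] /=.
- by rewrite apex_gaugeZ // links_gaugeZ // [RHS]maxr_pMr //
  mulr0 mulrBr -mulrDr mulrCA.
- by rewrite links_gaugeZ // mulrCA.
- by rewrite apex_gaugeZ // mulrCA.
Qed.

Lemma of_suspensionZ c z : 0 <= c ->
  of_suspension (fun i => c * z i) = (fun u => c * of_suspension z u).
Proof.
move=> c0; apply/funext => u; rewrite /of_suspension !mulrDr maxr_pMr //.
rewrite mulr0 mulrBr mulrA; congr (_ + _); rewrite mulr_sumr.
by apply: eq_bigr => e _; rewrite edge_gaugeZ // maxr_pMr // mulr0 mulrBr.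
Qed.

Lemma max0B (a b : R) : 0 <= a -> b = 0 -> Num.max 0 (a - b) = a.
Proof. by move=> a0 ->; rewrite subr0; apply/max_r. Qed.

Lemma max0B_gt0 (a b : R) : (0 < Num.max 0 (a - b)) = (b < a).
Proof. by rewrite lt_max ltxx subr_gt0. Qed.

(** Edge gauges are nonnegative, so at threshold 0 no link receives positive weight. *)
Lemma of_suspension_tip0 z : (forall i, 0 <= z i) -> z (inr false) = 0 ->
  of_suspension z = (fun u => z (inl u) + z (inr true) * (u == v)%:R).
Proof.
move=> z0 q0; apply/funext => u; rewrite /of_suspension q0 max0B //.
rewrite big1 ?addr0 // => e _; apply/max_l.
by rewrite sub0r oppr_le0 edge_gauge_ge0.
Qed.

Lemma to_suspension0 x : (forall u, 0 <= x u) ->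
  to_suspension 0 x = (fun i => if i is inl u then x u else 0).
Proof. by move=> x0; apply/funext => -[u|[]] /=; rewrite mul0r // max0B. Qed.

Lemma of_suspension_base x : (forall u, 0 <= x u) ->
  of_suspension (fun i => if i is inl u then x u else 0) = x.
Proof.
move=> x0; rewrite of_suspension_tip0 //; last by case.
by apply/funext => u; rewrite mul0r addr0.
Qed.

(** Only [v] can enter the support, and [A] is a cone with apex [v]. *)
Lemma of_suspension_apex z : (forall i, 0 <= z i) -> z (inr false) = 0 ->
  cut 0 (base z) \in A -> cut 0 (of_suspension z) \in A.
Proof.
have inA T : (T \in A) = ((T :|: [set v])%SET \in Ind) by rewrite inE.
move=> z0 q0; rewrite !inA; apply: independentS.
rewrite of_suspension_tip0 //; apply/fintype.subsetP => u; rewrite !inE.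
have [//|uv] := eqVneq u v; first by rewrite !orbT.
by rewrite mulr0 addr0.
Qed.

(* Each link [e :\ v] of positive weight forms a face with the vertices whose
   weight exceeds that of [inr false]; hence so does their union. *)
Lemma of_suspension_links z : (forall i, 0 <= z i) -> z (inr true) = 0 ->
  cut 0 (base z) \in B -> cut 0 (of_suspension z) \in B.
Proof.
move=> z0 p0 zB; have [q0|q0] := eqVneq (z (inr false)) 0.
  rewrite of_suspension_tip0 //; apply: star_linksS zB.
  by apply/fintype.subsetP => u; rewrite !inE p0 mul0r addr0.
pose S := [set e in H | (v \in e) &&
  (edge_gauge H v e (base z) < z (inr false))]%SET.
have vT : v \notin cut (z (inr false)) (base z).
  apply: contra (star_links_apex zB); rewrite !inE; exact: le_lt_trans.
have q_gt0 : 0 < z (inr false) by rewrite lt0r q0 z0.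
apply: (@star_linksS _ _ _ (cut (z (inr false)) (base z) :|: \bigcup_(e in S)
  (e :\ v))%SET).
  apply/fintype.subsetP => u; rewrite !inE /of_suspension p0 mul0r addr0 =>
    u_gt0.
  have [//|uq] := boolP (z (inr false) < z (inl u)).
  apply/finset.bigcupP; move: u_gt0; rewrite max_l ?subr_le0 ?leNgt //
    add0r => s0.
  have [e /andP[eH /andP[ve ue]]] : exists2 e, (e \in H) && ((v \in e) &&
    (u \in (e :\ v)%SET)) & Num.max 0 (z (inr false)
      - edge_gauge H v e (base z)) != 0.
    apply/exists_inP; apply: contraTT s0; rewrite negb_exists_in =>
      /forall_inP h.
    rewrite big1 ?ltxx // => e /h; by rewrite negbK => /eqP.
  move=> e0; exists e => //; rewrite inE eH ve -max0B_gt0.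
  by rewrite lt0r e0 le_max lexx.
apply: star_linksU => //.
  (* [S] is nonempty: a link compatible with the whole base has gauge at most 0, below the positive
     weight of [inr false]. *)
  have /star_linksP[e [eH ve]] := zB; rewrite -edge_gauge_indep //; last first.
    exact: star_links_apex zB.
  by move=> le0; apply/finset.set0Pn; exists e;
    rewrite inE eH ve (le_lt_trans le0).
move=> e; rewrite inE => /and3P[eH ve eq]; split=> //.
by rewrite -edge_gauge_indep // ltW.
Qed.

Lemma of_suspension_gt0_link z e u : (forall i, 0 <= z i) ->
  e \in H -> v \in e -> u \in (e :\ v)%SET ->
  edge_gauge H v e (base z) < z (inr false) -> 0 < of_suspension z u.
Proof.
move=> z0 eH ve ue ez; rewrite /of_suspension ltr_wpDl //.
  by rewrite addr_ge0 ?mulr_ge0 // le_max lexx.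
rewrite (bigD1 e) ?eH ?ve //= ltr_pwDl ?max0B_gt0 //.
by apply: sumr_ge0 => f _; rewrite le_max lexx.
Qed.

Lemma heavy_link z : (forall i, 0 <= z i) -> cut 0 (base z) \in B ->
  0 < z (inr false) ->
  exists e, [/\ e \in H, v \in e & edge_gauge H v e (base z) < z (inr false)].
Proof.
move=> z0 zB q0; have /star_linksP[e [eH ve]] := zB.
rewrite -edge_gauge_indep //; last exact: star_links_apex zB.
by move=> le0; exists e; split=> //; exact: le_lt_trans le0 q0.
Qed.

(** Truncation may remove every base vertex, but only if [inr false] has positive weight; then some
    link, which is nonempty, receives positive weight. *)
Lemma of_suspension_gt0 z : (forall i, 0 <= z i) -> (exists i, 0 < z i) ->
  (z (inr false) = 0 \/ cut 0 (base z) \in B) ->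
  exists u, 0 < of_suspension z u.
Proof.
move=> z0 [i zi] zB; have [q0|q0] := eqVneq (z (inr false)) 0.
  rewrite of_suspension_tip0 //; case: i zi => [u zu|[] zi].
  - by exists u; rewrite ltr_pwDl // mulr_ge0.
  - by exists v; rewrite eqxx mulr1 ltr_wpDl.
  - by rewrite q0 ltxx in zi.
have {}q0 : 0 < z (inr false) by rewrite lt0r q0 z0.
case: zB => [q|zB]; first by rewrite q ltxx in q0.
have [e [eH ve ez]] := heavy_link z0 zB q0.
have /finset.set0Pn[u ue] := link_neq0 v hypH eH.
by exists u; exact: (of_suspension_gt0_link z0 eH ve ue ez).
Qed.

(** This keeps [to_suspension] from giving positive weight to both tips. *)
Lemma gauges_disjoint x : (forall u, 0 <= x u) -> cut 0 x \in Ind ->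
  apex_gauge H v x = 0 \/ links_gauge H v x = 0.
Proof.
move=> x0 xI; have /orP[xA|xB] := star_apexU_links v xI; [left|right].
  by apply/eqP; rewrite apex_gauge_eq0.
by apply/eqP; rewrite links_gauge_eq0.
Qed.

(** The truncation level is at least each of the two gauges, so what survives is a face of both
    stars. *)
Lemma to_suspension_cut x : (forall u, 0 <= x u) -> cut 0 x \in Ind ->
  cut 0 (base (to_suspension 1 x)) \in C.
Proof.
move=> x0 xI; set d := apex_gauge H v x + links_gauge H v x.
have d0 : 0 <= d by rewrite addr_ge0 ?apex_gauge_ge0 ?links_gauge_ge0.
have -> : cut 0 (base (to_suspension 1 x)) = cut d x.
  by apply/setP => u; rewrite !inE /= mul1r max0B_gt0.
have dI : cut d x \in Ind by apply: independentS xI; exact: cutS.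
rewrite inE -apex_gauge_le // -links_gauge_le //.
by rewrite lerDl lerDr apex_gauge_ge0 links_gauge_ge0.
Qed.

(** If both tips have weight 0, the truncation level is 0 as well and no base weight is lost. *)
Lemma to_suspension_gt0 r x : 0 <= r -> (forall u, 0 <= x u) ->
  (exists u, 0 < x u) -> exists i, 0 < to_suspension r x i.
Proof.
move=> r0 x0 [u xu]; have rA := mulr_ge0 r0 (apex_gauge_ge0 H v x).
have rB := mulr_ge0 r0 (links_gauge_ge0 H v x0).
have [pA|pA] := eqVneq (r * apex_gauge H v x) 0; last first.
  by exists (inr false); rewrite /= lt0r pA.
have [pB|pB] := eqVneq (r * links_gauge H v x) 0; last first.
  by exists (inr true); rewrite /= lt0r pB.
by exists (inl u); rewrite /= max0B_gt0 mulrDr pA pB addr0.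
Qed.

(** For [r < 1] the intermediate base need not be a face of both stars. It still lies in whichever
    of [A] and [B] contains the support of [x], the opposite tip has weight 0, and [of_suspension]
    preserves that star. *)
Lemma of_to_suspension r x : 0 <= r -> (forall u, 0 <= x u) ->
  (exists u, 0 < x u) -> cut 0 x \in Ind ->
  (exists u, 0 < of_suspension (to_suspension r x) u) /\
  cut 0 (of_suspension (to_suspension r x)) \in Ind.
Proof.
move=> r0 x0 xP xI; have z0 := to_suspension_ge0 r0 x0.
have sub : cut 0 (base (to_suspension r x)) \subset cut 0 x.
  apply/fintype.subsetP => u; rewrite !inE /= max0B_gt0; apply: le_lt_trans.
  by rewrite mulr_ge0 // addr_ge0 ?apex_gauge_ge0 ?links_gauge_ge0.
have zP := to_suspension_gt0 r0 x0 xP.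
have [pA|pB] := gauges_disjoint x0 xI.
  have q0 : to_suspension r x (inr false) = 0 by rewrite /= pA mulr0.
  split; first by apply: of_suspension_gt0 => //; left.
  apply: (@star_apex_indep _ _ v); apply: of_suspension_apex => //.
  by apply: star_apexS sub _; rewrite -apex_gauge_eq0 // pA.
have zB : cut 0 (base (to_suspension r x)) \in B.
  by apply: star_linksS sub _; rewrite -links_gauge_eq0 // pB.
split; first by apply: of_suspension_gt0 => //; right.
apply: (@star_links_indep _ _ v); apply: of_suspension_links => //.
by rewrite /= pB mulr0.
Qed.

Lemma suspension_cut (X : {set {set V}}) z : (forall i, 0 <= z i) ->
  (cut 0 z \in suspension X) =
  (cut 0 (base z) \in X) && ((z (inr true) == 0) || (z (inr false) == 0)).
Proof.
move=> z0; rewrite !inE !lt0r !z0 !andbT -negb_or negbK.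
have -> // : [set u | inl u \in cut 0 z]%SET = cut 0 (base z).
by apply/setP => u; rewrite !inE.
Qed.

Lemma flatten_tips_ge0 r z : 0 <= r -> (forall i, 0 <= z i) ->
  forall i, 0 <= flatten_tips r z i.
Proof. by move=> r0 z0 [u|b] //=; rewrite mulr_ge0. Qed.

(** A tip of weight 0 keeps weight 0: if it is [inr true], the intermediate point [w] has support in
    [B], so its links gauge, the new weight of that tip, vanishes. The case of [inr false] is the
    same with [A] and the apex gauge. *)
Lemma push_tips_suspension r z : 0 <= r <= 1 -> (forall i, 0 <= z i) ->
  (exists i, 0 < z i) -> cut 0 z \in suspension C ->
  [/\ forall i, 0 <= push_tips r z i, exists i, 0 < push_tips r z i &
      cut 0 (push_tips r z) \in suspension C].
Proof.
move=> /andP[r0 r1] z0 zP; rewrite suspension_cut // => /andP[].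
rewrite inE => /andP[zA zB] st0.
have y0 := flatten_tips_ge0 r0 z0; set y := flatten_tips r z in y0.
have yA : cut 0 (base y) \in A by [].
have yB : cut 0 (base y) \in B by [].
have w0 := of_suspension_ge0 y0; set w := of_suspension y in w0.
have wst : (z (inr true) = 0 /\ cut 0 w \in B) \/ (z (inr false) = 0 /\
  cut 0 w \in A).
  case/orP: st0 => /eqP s0; [left|right]; split=> //.
    by apply: of_suspension_links => //; rewrite /y /= s0 mulr0.
  by apply: of_suspension_apex => //; rewrite /y /= s0 mulr0.
have wI : cut 0 w \in Ind.
  by case: wst => -[_]; [exact: star_links_indep|exact: star_apex_indep].
have r1' : 0 <= 1 - r by rewrite subr_ge0.
have k0 i : 0 <= push_tips r z i.
  rewrite addr_ge0 ?to_suspension_ge0 //.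
  by case: i => // b; rewrite mulr_ge0.
split=> //; last first.
  rewrite suspension_cut //; apply/andP; split.
    have -> : cut 0 (base (push_tips r z)) = cut 0 (base (to_suspension 1 w)).
      by apply/setP => u; rewrite !inE /push_tips addr0.
    exact: to_suspension_cut.
  case: wst => -[s0 wX]; rewrite /push_tips s0 mulr0 addr0 /= !mul1r.
    by rewrite links_gauge_eq0 // wX.
  by rewrite apex_gauge_eq0 // wX orbT.
(* If flattening leaves no weight at all, then [z] has weight on a tip and [r < 1], so the added
   term at that tip is positive. *)
have [[i yi]|yN] := pselect (exists i, 0 < y i).
  have [|u wu] := @of_suspension_gt0 y y0 (ex_intro _ i yi); first by right.
  have [j wj] := to_suspension_gt0 ler01 w0 (ex_intro _ u wu).
  exists j; rewrite ltr_pwDl //; case: j {wj} => // b; exact: mulr_ge0.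
case: zP => -[u|b] zi; first by case: yN; exists (inl u).
exists (inr b); rewrite ltr_wpDl ?to_suspension_ge0 // mulr_gt0 // subr_gt0.
rewrite ltNge; apply/negP => r1''; apply: yN; exists (inr b).
by rewrite /y /= mulr_gt0 // (lt_le_trans ltr01).
Qed.

(** With flattened tips [of_suspension] returns the base, which is a face of both stars; hence both
    gauges vanish. *)
Lemma push_tips0 z : (forall i, 0 <= z i) -> cut 0 z \in suspension C ->
  push_tips 0 z = z.
Proof.
move=> z0; rewrite suspension_cut // inE => /andP[/andP[zA zB] _].
have -> : push_tips 0 z = fun i => to_suspension 1 (base z) i +
     match i with inl _ => 0 | inr b => z (inr b) end.
  rewrite /push_tips; have -> : flatten_tips 0 z = fun i =>
    if i is inl u then z (inl u) else 0.
    by apply/funext => -[u|b] //=; rewrite mul0r.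
  rewrite (@of_suspension_base (base z)) //.
  by apply/funext => -[u|b] //; rewrite subr0 mul1r.
have pA : apex_gauge H v (base z) = 0.
  by apply/eqP; rewrite apex_gauge_eq0 // (star_apex_indep zA).
have pB : links_gauge H v (base z) = 0 by apply/eqP; rewrite links_gauge_eq0.
apply/funext => -[u|[]] /=; rewrite ?pA ?pB ?mul1r ?add0r //.
by rewrite addr0 max0B // addr0.
Qed.

Lemma push_tips1 z : push_tips 1 z = to_suspension 1 (of_suspension z).
Proof.
have -> : push_tips 1 z = fun i => to_suspension 1 (of_suspension (flatten_tips
  1 z)) i.
  by apply/funext => -[u|b]; rewrite /push_tips ?subrr ?mul0r addr0.
by congr (to_suspension 1 (of_suspension _)); apply/funext => -[u|b] //=;
  rewrite mul1r.
Qed.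

(** * Joint continuity in the homotopy parameter and the point *)

Section MapContinuity.
Variable T : topologicalType.

Lemma continuous_to_suspension (r : T -> R) (x : T -> V -> R) :
  continuous r -> (forall u, continuous (fun p => x p u)) ->
  forall i, continuous (fun p => to_suspension (r p) (x p) i).
Proof.
move=> rc xc; have cA : continuous (fun p => apex_gauge H v (x p))
  by exact: continuous_apex_gauge.
have cB : continuous (fun p => links_gauge H v (x p))
  by exact: continuous_links_gauge.
have c0 : continuous (fun _ : T => 0 : R) by move=> p; exact: cvg_cst.
case=> [u|[]] /=; [|exact: continuous_mulr|exact: continuous_mulr].
apply: continuous_maxr => //; apply: continuous_subr; first exact: xc.
by apply: continuous_mulr => //; exact: continuous_addr.
Qed.

Lemma continuous_of_suspension (z : T -> V + bool -> R) :
  (forall i, continuous (fun p => z p i)) ->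
  forall u, continuous (fun p => of_suspension (z p) u).
Proof.
move=> zc u; have c0 (c : R) : continuous (fun _ : T => c) by move=> p;
  exact: cvg_cst.
apply: continuous_addr; first apply: continuous_addr.
- by apply: continuous_maxr => //; exact: continuous_subr.
- exact: continuous_mulr.
apply: continuous_sumr => e _; apply: continuous_maxr => //.
apply: continuous_subr => //; apply: continuous_edge_gauge => w; exact: zc.
Qed.

Lemma continuous_push_tips (r : T -> R) (z : T -> V + bool -> R) :
  continuous r -> (forall i, continuous (fun p => z p i)) ->
  forall i, continuous (fun p => push_tips (r p) (z p) i).
Proof.
move=> rc zc i; have c0 (c : R) : continuous (fun _ : T => c) by move=> p;
  exact: cvg_cst.
apply: continuous_addr.
  apply: continuous_to_suspension => // u; apply: continuous_of_suspension.
  by case=> [w|b] /=; [exact: zc | exact: continuous_mulr].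
case: i => // b; apply: continuous_mulr => //; exact: continuous_subr.
Qed.

End MapContinuity.
End SuspensionMaps.

(** * Assembly of the homotopy equivalence *)

Theorem theorem1p1 (R : realType) (V : finType) (H : {set {set V}}) (v : V)
    (hH : is_hypergraph H)
    (hv : ~ isolated_vertex H v)
    (hcycle : ~ in_induced_berge_cycle H 3 v) :
  complex_homotopy_equivalent R
    (independence_complex H)
    (suspension
       (star (independence_complex H) [set v] :&:
        \bigcup_(e in H | v \in e)
           star (independence_complex H) (e :\ v))%SET).
Proof.
set X := independence_complex H; set Y := suspension _.
have fX (r : R) (x : {ptws V -> R}) : 0 <= r -> realization R X x ->
    (exists u, 0 < of_suspension H v (to_suspension H v r x) u) /\
    cut 0 (of_suspension H v (to_suspension H v r x)) \in X.
  move=> r0 xX; apply: of_to_suspension => //.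
  - exact: realization_ge0 xX.
  - exact: realization_gt0 xX.
  - exact: realization_cut xX.
have gY (r : R) (z : {ptws V + bool -> R}) : 0 <= r <= 1 -> realization R Y z ->
    [/\ forall i, 0 <= push_tips H v r z i, exists i, 0 < push_tips H v r z i &
        cut 0 (push_tips H v r z) \in Y].
  move=> r01 zY; apply: push_tips_suspension => //.
  - exact: realization_ge0 zY.
  - exact: realization_gt0 zY.
  - exact: realization_cut zY.
have c1 (T : topologicalType) : continuous (fun _ : T => 1 : R).
  by move=> p; exact: cvg_cst.
have cfst (W : finType) w : continuous (fun p : {ptws W -> R} * R => p.1 w).
  move=> p; apply: (@continuous_comp _ _ _ fst (fun x : {ptws W -> R} => x w)).
    exact: cvg_fst.
  exact: continuous_eval.
have csnd (W : finType) : continuous (fun p : {ptws W -> R} * R => 1 - p.2).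
  apply: continuous_subr => // p; exact: cvg_snd.
pose f (x : {ptws V -> R}) := normalize (to_suspension H v 1 x).
pose g (z : {ptws V + bool -> R}) := normalize (of_suspension H v z).
have fP x : realization R X x -> [/\ forall i, 0 <= to_suspension H v 1 x i,
   (exists i, 0 < to_suspension H v 1 x i) & cut 0 (to_suspension H v 1 x)
     \in Y].
  move=> xX; have x0 := realization_ge0 xX; have xI := realization_cut xX.
  have y0 := to_suspension_ge0 H v ler01 x0; split=> //.
    by apply: to_suspension_gt0 => //; exact: realization_gt0 xX.
  rewrite suspension_cut // to_suspension_cut //= !mul1r.
  by have [->|->] := gauges_disjoint hH hv x0 xI; rewrite eqxx ?orbT.
have gP z : realization R Y z -> [/\ forall i, 0 <= of_suspension H v z i,
   (exists i, 0 < of_suspension H v z i) & cut 0 (of_suspension H v z) \in X].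
  move=> zY; have z0 := realization_ge0 zY.
  have := realization_cut zY; rewrite suspension_cut // inE =>
    /andP[/andP[zA zB] st0].
  split; first exact: of_suspension_ge0.
    by apply: of_suspension_gt0 => //; [exact: realization_gt0 zY|right].
  case/orP: st0 => /eqP s0.
    by apply: (@star_links_indep _ _ v); apply: of_suspension_links.
  by apply: (@star_apex_indep _ _ v); apply: of_suspension_apex.
exists f, g; split.
- split=> [|x /fP[]]; last exact: normalize_realization.
  apply: continuous_normalize => [i|x /fP[? ? _]]; last exact/sum_gt0P.
  by apply: continuous_to_suspension => // u; exact: continuous_eval.
- split=> [|z /gP[]]; last exact: normalize_realization.
  apply: continuous_normalize => [i|x /gP[? ? _]]; last exact/sum_gt0P.
  by apply: continuous_of_suspension => // u; exact: continuous_eval.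
- have ge0 r (x : {ptws V -> R}) : 0 <= r -> realization R X x ->
    forall u, 0 <= of_suspension H v (to_suspension H v r x) u.
    move=> r0 xX; apply: of_suspension_ge0; apply: to_suspension_ge0 => //.
    exact: realization_ge0 xX.
  (* The parameter runs from 1 down to 0: time 0 is the composite, and at time 1 the gauges are
     scaled away. *)
  exists (fun p => normalize (of_suspension H v (to_suspension H v (1 - p.2)
    p.1))).
  split=> [|x t xX /andP[t0 t1]|x xX|x xX].
  + apply: continuous_normalize => [u|[x t] [/= xX]].
      apply: continuous_of_suspension; apply: continuous_to_suspension.
        exact: csnd.
      exact: cfst.
    rewrite in_itv /= => /andP[t0 t1]; apply/sum_gt0P.
      by apply: ge0 => //; rewrite subr_ge0.
    by apply: (fX _ _ _ xX).1; rewrite subr_ge0.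
  + have t1' : 0 <= 1 - t by rewrite subr_ge0.
    by have [? ?] := fX _ _ t1' xX; apply: normalize_realization => //;
      exact: ge0.
  (* The normalization done by [f] is a positive factor; homogeneity pulls it through
     [of_suspension] and the outer normalization cancels it. *)
  + rewrite /= subr0 /g /f [normalize (to_suspension _ _ _ _)]normalizeE
    of_suspensionZ ?normalizeZ //.
      rewrite invr_neq0 // gt_eqF //; apply/sum_gt0P; by have [] := fP _ xX.
    by rewrite invr_ge0; apply: sumr_ge0 => i _; have [] := fP _ xX.
  + have x0 := realization_ge0 xX; rewrite /= subrr to_suspension0 //.
    by rewrite of_suspension_base // normalize_id // (realization_sum xX).
exists (fun p => normalize (push_tips H v (1 - p.2) p.1)).
split=> [|z t zY /andP[t0 t1]|z zY|z zY].
- apply: continuous_normalize => [u|[z t] [/= zY]].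
    by apply: continuous_push_tips; [exact: csnd|exact: cfst].
  rewrite in_itv /= => /andP[t0 t1].
  have t01 : 0 <= 1 - t <= 1 by rewrite subr_ge0 t1 gerBl.
  by have [? ? _] := gY _ _ t01 zY; apply/sum_gt0P.
- have t01 : 0 <= 1 - t <= 1 by rewrite subr_ge0 t1 gerBl.
  by have [? ? ?] := gY _ _ t01 zY; apply: normalize_realization.
- rewrite /= subr0 push_tips1 /g /f [normalize (of_suspension _ _ _)]normalizeE.
  have [? ? _] := gP _ zY.
  rewrite to_suspensionZ ?normalizeZ //.
    by rewrite invr_neq0 // gt_eqF //; apply/sum_gt0P.
  by rewrite invr_ge0; exact: sumr_ge0.
- have z0 := realization_ge0 zY; rewrite /= subrr push_tips0 //.
    by rewrite normalize_id // (realization_sum zY).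
  exact: realization_cut zY.
Qed.
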